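(* Suppose $A:\mathcal B\to\mathbb R$ belongs to the class $\mathcal D$, and let $\psi_A(x)=\int_{\mathcal B^*}e^{W(y|x)-c}\,d\rho_{A^*}(y)$ be the main eigenfunction of $\mathcal L_A$, where $W$ is an involution kernel for $A$ whose associated $A^*$ is Hölder continuous. Then $\psi_A$ is differentiable in each coordinate $x_j$, and for every $j\in\mathbb N$, $$\frac{\partial}{\partial x_j}\psi_A(x)=\int_{\mathcal B^*}e^{W(y|x)-c}\sum_{n\ge1}D_{n+j}A(y_n,\dots,y_1,x_1,x_2,\dots)\,d\rho_{A^*}(y).$$
   Context: $M=S^1$ is the circle, $\nu$ is Lebesgue measure on $S^1$ normalized to a probability, $\mathbb N=\{1,2,\dots\}$, $\mathcal B=(S^1)^{\mathbb N}$ with metric $d(x,y)=\sum_{n\ge1}2^{-n}d_{S^1}(x_n,y_n)$, and $\sigma$ is the shift on $\mathcal B$. $\mathcal B^*=\{(\dots,y_2,y_1)\in(S^1)^{\mathbb N}\}$ with the analogous metric, $\hat{\mathcal B}=\mathcal B^*\times\mathcal B=(S^1)^{\mathbb Z}$ with elements $(y|x)=(\dots,y_2,y_1|x_1,x_2,\dots)$, and $\hat\sigma(\dots,y_2,y_1|x_1,x_2,\dots)=(\dots,y_2,y_1,x_1|x_2,x_3,\dots)$. For $a\in S^1$: $ax=(a,x_1,x_2,\dots)$, $ya=(\dots,y_2,y_1,a)$. An involution kernel for a continuous $A:\mathcal B\to\mathbb R$ (viewed as a function on $\hat{\mathcal B}$, $A(y|x)=A(x)$) is a continuous $W:\hat{\mathcal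 B}\to\mathbb R$ such that $A^*:=A\circ\hat\sigma^{-1}+W\circ\hat\sigma^{-1}-W$ depends only on $y$; then $A^*$ is viewed as a function on $\mathcal B^*$. Ruelle operators: $\mathcal L_A(\varphi)(x)=\int_{S^1}e^{A(ax)}\varphi(ax)\,d\nu(a)$ on continuous functions on $\mathcal B$ and $\mathcal L_{A^*}(\varphi)(y)=\int_{S^1}e^{A^*(ya)}\varphi(ya)\,d\nu(a)$ on continuous functions on $\mathcal B^*$; duals act on measures by $\int\varphi\,d\mathcal L^*(\mu)=\int\mathcal L(\varphi)\,d\mu$. For Hölder $A$ there are $\lambda_A>0$ and a strictly positive Hölder eigenfunction, unique up to a multiplicative constant (the main eigenfunction), with $\mathcal L_A\psi=\lambda_A\psi$, and a finite positive Borel measure $\rho_A$ (unique up to scaling) with $\mathcal L_A^*(\rho_A)=\lambda_A\rho_A$; $\lambda_{A^*},\rho_{A^*}$ are the analogous objects for $A^*$ on $\mathcal B^*$. The constant $c$ is such that $\iint e^{W(y|x)-c}\,d\rho_{A^*}(y)\,d\rho_A(x)=1$; the function $x\mapsto\int_{\mathcal B^*}e^{W(y|x)-c}d\rho_{A^*}(y)$ is a main eigenfunction of $\mathcal L_A$. Class $\mathcal D$: $A:\mathcal B\to\mathbb R$ belongs to $\mathcal D$ if $A$ is Lipschitz continuous and (a) $A$ is differentiable in each coordinate $x_j$, with derivative $D_jA$ with respect to the $j$-th coordinate; (b) for every $\varepsilon>0$ there is $H_\varepsilon>0$ such that for all $x\in\mathcal B$, all $j\in\mathbb N$ and all $h$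 with $0<|h|<H_\varepsilon$, $\left|\frac{A(x+he_j)-A(x)}{h}-D_jA(x)\right|\le\frac{\varepsilon}{2^j}$, where $x+he_j$ is $x$ with $h$ added to the angular coordinate $x_j$. *)

(* Defs.v *)
From HB Require Import structures.
From mathcomp Require Import all_boot all_order all_algebra archimedean.
From mathcomp Require Import all_classical all_reals all_analysis.
From mathcomp Require Import measurable_realfun lra.

Set Implicit Arguments.
Unset Strict Implicit.
Unset Printing Implicit Defensive.

Import Order.TTheory GRing.Theory Num.Theory.
Import numFieldNormedType.Exports.

Local Open Scope classical_set_scope.
Local Open Scope ring_scope.

(* S^1 is modelled as R/Z: a point is its angular coordinate, in turns, in
   [0, 1[. *)
Record circle (R : realType) := Circle {
  angle : R ;
  angle_itv : 0 <= angle < 1 }.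

Section Circle.
Context {R : realType}.
Implicit Types (a b c : circle R) (t s : R).

HB.instance Definition _ := [isSub for @angle R].
HB.instance Definition _ := [Choice of circle R by <:].

Lemma circle0_subproof : 0 <= (0 : R) < 1.
Proof. by rewrite lexx ltr01. Qed.

HB.instance Definition _ := isPointed.Build (circle R)
  (Circle circle0_subproof).

Lemma circle_proj_subproof t : 0 <= t - (Num.floor t)%:~R < 1.
Proof.
have /andP[] := floor_itv t; rewrite intrD => h1 h2.
by apply/andP; split; lra.
Qed.

Definition circle_proj t : circle R := Circle (circle_proj_subproof t).

Definition circle_dist a b : R :=
  Num.min `|angle a - angle b| (1 - `|angle a - angle b|).

Lemma circle_distxx a : circle_dist a a = 0.
Proof. by rewrite /circle_dist subrr normr0 subr0 min_l. Qed.

Lemma circle_dist_sym a b : circle_dist a b = circle_dist b a.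
Proof. by rewrite /circle_dist distrC. Qed.

Lemma circle_dist_positivity a b : circle_dist a b = 0 -> a = b.
Proof.
move=> ab; apply: val_inj => /=; move: ab; rewrite /circle_dist minEle.
have /andP[a0 a1] := angle_itv a; have /andP[b0 b1] := angle_itv b.
case: ifPn => _; first by move/eqP; rewrite normr_eq0 subr_eq0 => /eqP.
by case: (ler0P (angle a - angle b)) => h h1; lra.
Qed.

Lemma circle_dist_triangle b a c :
  circle_dist a c <= circle_dist a b + circle_dist b c.
Proof.
rewrite /circle_dist.
have /andP[a0 a1] := angle_itv a; have /andP[b0 b1] := angle_itv b.
have /andP[c0 c1] := angle_itv c.
move: (angle a) (angle b) (angle c) a0 a1 b0 b1 c0 c1 => x y z.
move=> x0 x1 y0 y1 z0 z1.
rewrite minEle (minEle `|x - y|) (minEle `|y - z|).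
by case: (ler0P (x - z)) => ?; case: (ler0P (x - y)) => ?;
  case: (ler0P (y - z)) => ?; repeat case: ifPn; rewrite -?ltNge => *; lra.
Qed.

HB.instance Definition _ := @isMetric.Build R (circle R) circle_dist
  circle_distxx circle_dist_positivity circle_dist_sym circle_dist_triangle.

HB.instance Definition _ := @isMeasurable.Build
  (sigma_display (@open (circle R))) (circle R) <<s @open (circle R) >>
  (@sigma_algebra0 _ setT _) (@sigma_algebraC _ _)
  (@sigma_algebra_bigcup _ setT _).

Lemma circle_dist_ge0 a b : 0 <= circle_dist a b.
Proof. exact: (@mdist_ge0 _ (circle R) a b). Qed.

Lemma circle_dist_le1 a b : circle_dist a b <= 1.
Proof. by rewrite /circle_dist ge_min lerBlDr lerDl normr_ge0 orbT. Qed.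

Lemma circle_dist_proj t s :
  circle_dist (circle_proj t) (circle_proj s) <= `|t - s|.
Proof.
rewrite /circle_dist /=.
have /andP[] := circle_proj_subproof t; have /andP[] := circle_proj_subproof s.
set m := Num.floor t; set n := Num.floor s => s0 s1 t0 t1.
rewrite ge_min; case: (ltgtP m n) => [mn|nm|->].
- have {}mn : m%:~R + 1 <= n%:~R :> R.
    by rewrite -[1]/(1%:~R) -intrD ler_int lezD1.
  apply/orP.
  case: (ler0P (t - s)) => ?;
  case: (ler0P (t - m%:~R - (s - n%:~R))) => ?; try (left; lra); right; lra.
- have {}nm : n%:~R + 1 <= m%:~R :> R.
    by rewrite -[1]/(1%:~R) -intrD ler_int lezD1.
  apply/orP.
  case: (ler0P (t - s)) => ?;
  case: (ler0P (t - m%:~R - (s - n%:~R))) => ?; try (left; lra); right; lra.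
- by apply/orP; left; rewrite opprD addrACA subrr addr0 // opprK addrC.
Qed.

Lemma continuous_circle_proj : continuous circle_proj.
Proof.
move=> t; apply/cvg_ballP => e e0; near=> s; rewrite ballEmdist /=.
apply: le_lt_trans (circle_dist_proj t s) _; near: s.
exact: (@cvgr_dist_lt _ _ _ (nbhs t) _ id t cvg_id e e0).
Unshelve. all: by end_near. Qed.

Lemma measurable_circle_proj :
  measurable_fun setT (circle_proj : measurableTypeR R -> circle R).
Proof.
apply: (measurability (@open (circle R))) => // _ [B oB <-].
rewrite setTI; apply: open_measurable.
by move/continuousP: continuous_circle_proj; apply.
Qed.

Definition circle_lebesgue : set (circle R) -> \bar R :=
  pushforward (mrestr lebesgue_measure (measurable_itv `[0%R, 1%R[))
    (circle_proj : measurableTypeR R -> circle R).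

Let circle_lebesgue_measure :=
  measure_function_pushforward__canonical__measure_function_Measure
  (mrestr lebesgue_measure (measurable_itv `[0%R, 1%R[)) measurable_circle_proj.

HB.instance Definition _ := isMeasure.Build _ _ _ circle_lebesgue
  (measure0 circle_lebesgue_measure) (measure_ge0 circle_lebesgue_measure)
  (@measure_semi_sigma_additive _ _ _ circle_lebesgue_measure).

Lemma circle_lebesgue_setT : circle_lebesgue setT = 1%E.
Proof.
rewrite /circle_lebesgue /pushforward /mrestr preimage_setT setTI.
rewrite lebesgue_measure_itv /=.
by rewrite lte_fin ltr01 oppr0 adde0.
Qed.

HB.instance Definition _ := Measure_isProbability.Build _ _ _
  circle_lebesgue circle_lebesgue_setT.

End Circle.

(* The sequence x_1, x_2, ... is stored as x 0, x 1, ...  A point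
   (..., y_2, y_1) of B^* is stored as the sequence y_1, y_2, ..., so that B^*
   is the same metric space as B. *)
Definition seqS1 (R : realType) := nat -> circle R.

Section SeqS1.
Context {R : realType}.
Implicit Types x y z : seqS1 R.

HB.instance Definition _ := gen_eqMixin (seqS1 R).
HB.instance Definition _ := gen_choiceMixin (seqS1 R).
HB.instance Definition _ := isPointed.Build (seqS1 R) (fun=> point).

Definition seq_dist_term x y : R ^nat :=
  fun n => 2 ^- n.+1 * mdist (x n) (y n).

Definition seq_dist x y : R := limn (series (seq_dist_term x y)).

Lemma seq_dist_term_ge0 x y n : 0 <= seq_dist_term x y n.
Proof. by rewrite mulr_ge0 ?invr_ge0 ?exprn_ge0 ?mdist_ge0. Qed.

Lemma is_cvg_seq_dist x y : cvgn (series (seq_dist_term x y)).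
Proof.
apply: (@series_le_cvg _ _ (geometric 2^-1 2^-1)).
- exact: seq_dist_term_ge0.
- by move=> n; rewrite /= mulr_ge0 ?exprn_ge0 ?invr_ge0.
- move=> n; rewrite /= -exprS exprVn ler_piMr ?invr_ge0 ?exprn_ge0 //.
  exact: circle_dist_le1.
- apply: is_cvg_geometric_series.
  by rewrite ger0_norm ?invr_ge0 // invf_lt1 ?ltr1n.
Qed.

Lemma seq_distxx x : seq_dist x x = 0.
Proof.
rewrite /seq_dist (_ : series _ = cst 0) ?lim_cst //; apply/funext => n.
by rewrite /series /= big1 // => i _; rewrite /seq_dist_term mdistxx mulr0.
Qed.

Lemma seq_dist_positivity x y : seq_dist x y = 0 -> x = y.
Proof.
move=> d0; apply/funext => n; apply/mdist_positivity/eqP.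
have nd : nondecreasing_seq (series (seq_dist_term x y)).
  apply/nondecreasing_seqP => k.
  by rewrite !seriesEnat /= big_nat_recr //= lerDl seq_dist_term_ge0.
have := nondecreasing_cvgn_le nd (is_cvg_seq_dist (x := x) (y := y)) n.+1.
rewrite -/(seq_dist x y) d0 seriesEnat /= big_nat_recr //= => le0.
have s0 : 0 <= \sum_(0 <= i < n) seq_dist_term x y i.
  by apply: sumr_ge0 => i _; exact: seq_dist_term_ge0.
have t0 : seq_dist_term x y n = 0.
  apply/eqP; rewrite eq_le seq_dist_term_ge0 andbT.
  by apply: le_trans le0; rewrite lerDr.
by move/eqP: t0; rewrite mulf_eq0 invr_eq0 expf_eq0 /= pnatr_eq0.
Qed.

Lemma seq_dist_sym x y : seq_dist x y = seq_dist y x.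
Proof.
by rewrite /seq_dist (_ : seq_dist_term x y = seq_dist_term y x) //;
  apply/funext => n; rewrite /seq_dist_term metric_sym.
Qed.

Lemma seq_dist_triangle y x z : seq_dist x z <= seq_dist x y + seq_dist y z.
Proof.
have cxy := @is_cvg_seq_dist x y; have cyz := @is_cvg_seq_dist y z.
rewrite /seq_dist -limD // -seriesD; apply: lim_series_le.
- exact: is_cvg_seq_dist.
- by rewrite seriesD; exact: is_cvgD.
- move=> n; rewrite /seq_dist_term /= -[leRHS]mulrDr ler_wpM2l //.
  exact: metric_triangle.
Qed.

HB.instance Definition _ := @isMetric.Build R (seqS1 R) seq_dist
  seq_distxx seq_dist_positivity seq_dist_sym seq_dist_triangle.

HB.instance Definition _ := @isMeasurable.Build
  (sigma_display (@open (seqS1 R))) (seqS1 R) <<s @open (seqS1 R) >>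
  (@sigma_algebra0 _ setT _) (@sigma_algebraC _ _)
  (@sigma_algebra_bigcup _ setT _).

End SeqS1.

Section InvolutionKernel.
Context {R : realType}.
Implicit Types (A f : seqS1 R -> R) (a : circle R) (x y : seqS1 R).

(* (a, x_1, x_2, ...) in B, and (..., y_2, y_1, a) in B^* *)
Definition scons a x : seqS1 R := fun n => if n is m.+1 then x m else a.

Definition shift x : seqS1 R := fun n => x n.+1.

(* (y_n, ..., y_1, x_1, x_2, ...) *)
Fixpoint prepend n y x : seqS1 R :=
  if n is m.+1 then scons (y m) (prepend m y x) else x.

(* A point (y|x) of (S^1)^Z is the pair (y, x). *)
Definition sigma_hat (p : seqS1 R * seqS1 R) : seqS1 R * seqS1 R :=
  (scons (p.2 0%N) p.1, shift p.2).

Definition sigma_hat_inv (p : seqS1 R * seqS1 R) : seqS1 R * seqS1 R :=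
  (shift p.1, scons (p.1 0%N) p.2).

Lemma scons_shift x : scons (x 0%N) (shift x) = x.
Proof. by apply/funext => -[]. Qed.

Lemma sigma_hatK : cancel sigma_hat sigma_hat_inv.
Proof. by move=> [y x]; rewrite /sigma_hat_inv /= scons_shift. Qed.

Lemma sigma_hat_invK : cancel sigma_hat_inv sigma_hat.
Proof. by move=> [y x]; rewrite /sigma_hat /= scons_shift. Qed.

(* A is viewed on (S^1)^Z through A(y|x) = A(x); Astar, being a function of y
   alone, is the dual potential A^*. *)
Definition involution_kernel A (W : seqS1 R * seqS1 R -> R)
    (Astar : seqS1 R -> R) :=
  continuous W /\
  forall y x, A (sigma_hat_inv (y, x)).2 + W (sigma_hat_inv (y, x)) - W (y, x)
              = Astar y.

Definition lipschitz_seq f :=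
  exists2 K : R, 0 <= K & forall x y, `|f x - f y| <= K * mdist x y.

Definition hoelder_seq f :=
  exists alpha K : R, [/\ 0 < alpha, alpha <= 1, 0 <= K &
    forall x y, `|f x - f y| <= K * mdist x y `^ alpha].

(* By the encoding of B^*, this is L_A on B as well as L_{A^*} on B^*. *)
Definition ruelle A f x : R :=
  \int[circle_lebesgue]_a (expR (A (scons a x)) * f (scons a x)).

Definition main_eigenfunction A (lambda : R) f :=
  [/\ hoelder_seq f, forall x, 0 < f x & forall x, ruelle A f x = lambda * f x].

(* lambda_A is the eigenvalue of a strictly positive Hoelder eigenfunction. *)
Definition main_eigenvalue A (lambda : R) :=
  0 < lambda /\ exists f, main_eigenfunction A lambda f.

Definition eigenmeasure A (lambda : R)
    (rho : {finite_measure set (seqS1 R) -> \bar R}) :=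
  (0 < rho setT)%E /\
  forall f, continuous f ->
    \int[rho]_x ruelle A f x = lambda * \int[rho]_x f x.

(* x + h e_j, where x_j is stored as x (j - 1) *)
Definition add_coord x (j : nat) (h : R) : seqS1 R :=
  fun i => if i == j then circle_proj (angle (x i) + h) else x i.

Definition coord_derivable (j : nat) f x :=
  derivable (fun h : R => f (add_coord x j h)) 0 1.

Definition coord_deriv (j : nat) f x : R :=
  derive1 (fun h : R => f (add_coord x j h)) 0.

(* 2 ^+ j.+1, because j counts the coordinates from 0. *)
Definition class_D A :=
  [/\ lipschitz_seq A,
      forall j x, coord_derivable j A x &
      forall eps : R, 0 < eps -> exists2 H : R, 0 < H &
        forall x (j : nat) (h : R), 0 < `|h| < H ->
          `|(A (add_coord x j h) - A x) / h - coord_deriv j A x|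
            <= eps / 2 ^+ j.+1].

End InvolutionKernel.

(* Main.v *)
Require Import Defs.
From HB Require Import structures.
From mathcomp Require Import all_boot all_order all_algebra.
From mathcomp Require Import all_classical all_reals all_analysis.
From mathcomp Require Import measurable_realfun ring lra.

(** Write x' for the point x with h added to its j-th coordinate.  Subtracting
    the cohomological equation of the involution kernel at (y|x) from the same
    equation at (y|x') makes the dual potential disappear and leaves
    W(y|x') - W(y|x) = A(y_1 x') - A(y_1 x) + W(z|y_1 x') - W(z|y_1 x),
    where z is y without its last letter y_1.  Iterating moves the perturbed
    letter further and further to the right, so that the remaining difference
    of W is taken between points at distance at most 2^-N; the space being
    compact, W is uniformly continuous and this remainder vanishes
    ([cvg_involution_kernel_sum]).  Hence W(y|x') - W(y|x) is the sum over n of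
    A(y_n ... y_1 x') - A(y_n ... y_1 x), a series which only involves A.

    In the n-th term it is coordinate n + j of the argument of A that moves.
    The weights 2^-(n+j) in the definition of the class D are summable in n, so
    the difference quotients of W converge to the series of the D_(n+j) A as h
    tends to 0, uniformly in y ([involution_kernel_derivative]).  The Lipschitz
    condition bounds D_i A by a multiple of 2^-i, so this series is bounded
    ([deriv_series_bound]).

    Uniform convergence survives composition with the exponential, because W is
    bounded above and the limit is bounded ([uniform_derivative0_expR]), and
    integration against a finite measure ([derivative_Rintegral]).  The
    integrand of the formula is measurable in y as a pointwise limit of
    difference quotients of the kernel, which are continuous in y
    ([measurable_uniform_derivative0]). *)

Import Order.TTheory GRing.Theory Num.Theory.
Import numFieldNormedType.Exports.

Local Open Scope classical_set_scope.
Local Open Scope ring_scope.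

Set Implicit Arguments.
Unset Strict Implicit.
Unset Printing Implicit Defensive.

(** * Compactness of the sequence space *)

Lemma seq_dist_le1 (R : realType) (x y : seqS1 R) : mdist x y <= 1.
Proof.
apply: limr_le; first exact: is_cvg_seq_dist.
apply: nearW => n; apply: (@le_trans _ _ (series (geometric 2^-1 2^-1) n)).
  apply: ler_sum => i _; rewrite /seq_dist_term /= -exprS exprVn.
  by rewrite ler_piMr ?invr_ge0 ?exprn_ge0 // circle_dist_le1.
rewrite geometric_seriesE; last by rewrite lt_eqF // invf_lt1 ?ltr1n.
rewrite /= (_ : 1 - 2^-1 = 2^-1 :> R); last by lra.
by rewrite mulrAC divff ?invr_eq0 // mul1r lerBlDr lerDl exprn_ge0 // invr_ge0.
Qed.

(** The weights 2^-n make the distance self-similar.  This recursion replaces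
    manipulations of the series in the metric arguments below. *)
Lemma seq_dist_shift (R : realType) (x y : seqS1 R) :
  mdist x y =
    2^-1 * (mdist (x 0%N) (y 0%N) + mdist (Defs.shift x) (Defs.shift y)).
Proof.
apply: cvg_lim => //; rewrite -(cvg_shiftS (series _)) /=.
have -> : (fun n => series (seq_dist_term x y) n.+1) =
    (fun n => 2^-1 * (mdist (x 0%N) (y 0%N) +
                      series (seq_dist_term (Defs.shift x) (Defs.shift y)) n)).
  apply/funext => n; rewrite !seriesEnat /= big_nat_recl //=.
  rewrite /seq_dist_term expr1 mulrDr; congr (_ + _).
  rewrite mulr_sumr; apply: eq_bigr => i _.
  by rewrite exprS invfM mulrA.
apply: cvgM; first exact: cvg_cst.
apply: cvgD; first exact: cvg_cst.
exact: is_cvg_seq_dist.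
Qed.

(** The coordinates beyond the N-th have total weight 2^-N, and each of them
    contributes at most its weight. *)
Lemma seq_dist_le_head (R : realType) (N : nat) (e : R) (x y : seqS1 R) :
  0 <= e -> (forall i, (i < N)%N -> mdist (x i) (y i) <= e) ->
  mdist x y <= e + 2^-1 ^+ N.
Proof.
move=> e0; elim: N x y => [|N IH] x y xy.
  by rewrite expr0 (le_trans (seq_dist_le1 _ _)) // lerDr.
have := xy 0%N isT; have := IH (Defs.shift x) (Defs.shift y) (fun i => xy i.+1).
by rewrite (seq_dist_shift x) exprS => h1 h2; lra.
Qed.

Lemma circle_projK (R : realType) (a : circle R) : circle_proj (angle a) = a.
Proof.
apply: val_inj => /=; rewrite (floor_def (m := 0)) ?subr0 //.
exact: angle_itv.
Qed.

Lemma compact_circle (R : realType) : compact [set: circle R].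
Proof.
have -> : [set: circle R] = circle_proj @` `[0, 1].
  apply/seteqP; split => // a _; exists (angle a).
    by rewrite /= in_itv /=; case/andP: (angle_itv a) => -> /ltW ->.
  exact: circle_projK.
apply: continuous_compact; last exact: segment_compact.
by apply: continuous_subspaceT; exact: continuous_circle_proj.
Qed.

(** The identity, from the product topology to the topology of the metric. *)
Definition seqS1_of_prod (R : realType)
  (f : prod_topology (fun _ : nat => circle R)) : seqS1 R := f.

Lemma continuous_seqS1_of_prod (R : realType) : continuous (@seqS1_of_prod R).
Proof.
move=> f.
apply/(@cvg_ballP R (seqS1 R) _ (nbhs f) _ (@seqS1_of_prod R)
  (seqS1_of_prod f)) => e e0.
have e20 : 0 < e / 2 by rewrite divr_gt0.
have [N _ /(_ N (leqnn N)) Ne] := near_infty_natSinv_expn_lt (PosNum e20).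
have pF n : nbhs f (fun g => ball (f n) (e / 2) (g n)).
  exact: (@cvg_ball R (circle R) _ (nbhs f) _ (proj n) (f n)
    (@proj_continuous _ (fun=> circle R) n f) _ e20).
(* The product topology is now forgotten: all that is kept of the
   neighbourhood filter of f is that every coordinate converges along it. *)
have FF : Filter (nbhs f) by exact: nbhs_filter.
move: (nbhs f) FF pF => F FF pF.
have near_head n :
    F (fun g => forall i, (i < n)%N -> mdist (f i) (g i) <= e / 2).
  elim: n => [|n IH]; first by apply: nearW => g i; rewrite ltn0.
  apply: filterS2 IH (pF n) => g IH; rewrite ballEmdist /= => gn i.
  by rewrite ltnS leq_eqVlt => /predU1P[->|/IH//]; exact: ltW.
apply: filterS (near_head N) => g fg; rewrite ballEmdist /=.
apply: (@le_lt_trans _ _ (e / 2 + 2^-1 ^+ N)).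
  exact: seq_dist_le_head (ltW e20) fg.
by rewrite [ltRHS]splitr ltrD2l exprVn -(mul1r (_ ^- _)).
Qed.

(** Tychonoff's theorem gives compactness for the product topology; it passes
    to the metric topology along the continuous identity map. *)
Lemma compact_seqS1 (R : realType) : compact [set: seqS1 R].
Proof.
have cP : compact [set f : prod_topology (fun _ : nat => circle R) |
    forall i : nat, [set: circle R] (f i)].
  exact: (@tychonoff _ (fun=> circle R) (fun=> setT)
    (fun=> @compact_circle R)).
have -> : [set: seqS1 R] =
    @seqS1_of_prod R @`
    [set f | forall i : nat, [set: circle R] (f i)].
  by apply/seteqP; split => // f _; exists f.
apply: continuous_compact cP; apply: continuous_subspaceT.
exact: continuous_seqS1_of_prod.
Qed.

Lemma compact_seqS1_pair (R : realType) :
  compact [set: (seqS1 R * seqS1 R)%type].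
Proof. by rewrite -setXTT; apply: compact_setX; exact: compact_seqS1. Qed.

(** The Heine-Cantor theorem, obtained from the near-covering form of
    compactness: it is enough to find, around each point, a neighbourhood and a
    range of radii d on which the estimate holds. *)
Lemma compact_uniformly_continuous (R : realType) (X : pseudoMetricType R)
    (f : X -> R) : compact [set: X] -> continuous f ->
  forall e, 0 < e -> exists2 d, 0 < d &
    forall x y, ball x d y -> `|f x - f y| < e.
Proof.
move=> /compact_near_coveringP cX cf e e0.
have e20 : 0 < e / 2 by rewrite divr_gt0.
pose P (d : R) x := forall y, ball x d y -> `|f x - f y| < e.
have : \forall d \near 0^'+, [set: X] `<=` P d.
  apply: cX => x _.
  have xe : \forall y \near x, `|f x - f y| < e / 2.
    exact: (@cvgr_dist_lt _ _ _ _ _ f (f x) (cf x) _ e20).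
  (* Halving the radius leaves room to move x as well as y. *)
  move/nbhs_ballP : xe => [r /= r0 xr].
  have r20 : 0 < r / 2 by rewrite divr_gt0.
  have rr : r / 2 <= r by lra.
  exists (ball x (r / 2), [set d | d <= r / 2]) => /=.
    by split; [exact: nbhsx_ballx|exact: nbhs_right_le].
  move=> [z d] /= [xz dr] y zy.
  have fz := xr z (le_ball rr xz).
  have fy := xr y _; rewrite /= in fz fy.
  have {}fy : `|f x - f y| < e / 2.
    apply: fy; rewrite [r]splitr; apply: ball_triangle xz _.
    exact: le_ball zy.
  rewrite [ltRHS]splitr (le_lt_trans (ler_distD (f x) _ _)) //.
  by rewrite ltrD // distrC.
have d0 : \forall d \near 0^'+, (0 : R) < d by exact: nbhs_right_gt.
move=> Pd; have [d [dp dP]] := filter_ex (filterI d0 Pd).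
by exists d => // x y; exact: dP.
Qed.

(** * Differences of an involution kernel as sums of differences of A *)

Lemma shift_add_coord (R : realType) (x : seqS1 R) (j : nat) (h : R) :
  Defs.shift (add_coord x j.+1 h) = add_coord (Defs.shift x) j h.
Proof. by []. Qed.

Lemma scons_add_coord (R : realType) (a : circle R) (x : seqS1 R) (j : nat)
  (h : R) : scons a (add_coord x j h) = add_coord (scons a x) j.+1 h.
Proof. by apply/funext => -[]. Qed.

(** Prepending n letters moves the perturbed coordinate n places to the right:
    this is where the index n + j of the formula comes from. *)
Lemma prepend_add_coord (R : realType) (n : nat) (y x : seqS1 R) (j : nat)
    (h : R) :
  prepend n y (add_coord x j h) = add_coord (prepend n y x) (n + j) h.
Proof. by elim: n => //= n ->; rewrite scons_add_coord. Qed.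

Lemma add_coord0 (R : realType) (x : seqS1 R) (j : nat) : add_coord x j 0 = x.
Proof.
by apply/funext => i; rewrite /add_coord addr0 circle_projK if_same.
Qed.

Lemma seq_dist_add_coord (R : realType) (x : seqS1 R) (j : nat) (h : R) :
  mdist (add_coord x j h) x <= `|h| / 2 ^+ j.+1.
Proof.
elim: j x => [|j IH] x; rewrite seq_dist_shift.
  have -> : Defs.shift (add_coord x 0 h) = Defs.shift x by apply/funext.
  rewrite mdistxx addr0 mulrC expr1 ler_wpM2r ?invr_ge0 // /add_coord eqxx.
  rewrite -[X in mdist _ X]circle_projK.
  by apply: le_trans (circle_dist_proj _ _) _; rewrite addrAC subrr add0r.
rewrite {1}/add_coord /= mdistxx add0r shift_add_coord.
by rewrite exprS invfM mulrCA ler_wpM2l ?invr_ge0.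
Qed.

Lemma seq_dist_prepend (R : realType) (n : nat) (y x x' : seqS1 R) :
  mdist (prepend n y x) (prepend n y x') = 2^-1 ^+ n * mdist x x'.
Proof.
elim: n => [|n IH] /=; first by rewrite expr0 mul1r.
rewrite seq_dist_shift /= mdistxx add0r exprS -mulrA -IH.
by congr (_ * mdist _ _); apply/funext.
Qed.

(** Telescoping.  The dual potential at the N-th shift of y is the same for
    both points, so it cancels and each step trades a difference of W for a
    difference of A plus a difference of W at closer points. *)
Lemma involution_kernel_diff (R : realType) (A : seqS1 R -> R)
    (W : seqS1 R * seqS1 R -> R) (Astar : seqS1 R -> R) (y x x' : seqS1 R)
    (N : nat) :
  involution_kernel A W Astar ->
  W (y, x') - W (y, x) =
    \sum_(1 <= n < N.+1) (A (prepend n y x') - A (prepend n y x)) +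
    (W (iter N Defs.shift y, prepend N y x') -
     W (iter N Defs.shift y, prepend N y x)).
Proof.
move=> [_ WA]; elim: N => [|N ->]; first by rewrite big_geq // add0r.
rewrite [in RHS]big_nat_recr //= -addrA; congr (_ + _).
(* The N-th shift of y starts with the letter that the next step prepends. *)
have iterE : iter N Defs.shift y 0%N = y N.
  have : forall i, iter N Defs.shift y i = y (N + i)%N.
    by elim: N => //= n IH i; rewrite /Defs.shift IH addnS.
  by move=> ->; rewrite addn0.
have := WA (iter N Defs.shift y) (prepend N y x').
have := WA (iter N Defs.shift y) (prepend N y x).
rewrite /sigma_hat_inv /= iterE => <- /eqP; rewrite -subr_eq0 => /eqP.
lra.
Qed.

(** Both points have the same past, and their futures share their first N
    letters, so that their distance is at most 2^-N while the points themselves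
    may wander: the continuity of W has to be uniform. *)
Lemma continuous_kernel_tail (R : realType) (W : seqS1 R * seqS1 R -> R)
    (y x x' : seqS1 R) : continuous W ->
  (fun N => W (iter N Defs.shift y, prepend N y x') -
            W (iter N Defs.shift y, prepend N y x)) @ \oo --> (0 : R).
Proof.
move=> cW; apply/cvgrPdist_lt => e e0.
have [d d0 Wd] := compact_uniformly_continuous (@compact_seqS1_pair R) cW e0.
have [N _ NP] := near_infty_natSinv_expn_lt (PosNum d0).
exists N => // n /NP /= nd; rewrite sub0r normrN; apply: Wd; split => /=.
  exact: ballxx.
rewrite ballEmdist /= seq_dist_prepend; apply: le_lt_trans nd.
by rewrite div1r -exprVn ler_piMr ?seq_dist_le1 ?exprn_ge0 ?invr_ge0.
Qed.

Lemma cvg_involution_kernel_sum (R : realType) (A : seqS1 R -> R)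
    (W : seqS1 R * seqS1 R -> R) (Astar : seqS1 R -> R) (y x x' : seqS1 R) :
  involution_kernel A W Astar ->
  (fun N => \sum_(1 <= n < N) (A (prepend n y x') - A (prepend n y x))) @ \oo
    --> W (y, x') - W (y, x).
Proof.
move=> WA; rewrite -cvg_shiftS.
pose r N := W (iter N Defs.shift y, prepend N y x') -
  W (iter N Defs.shift y, prepend N y x).
have -> : (fun N => \sum_(1 <= n < N.+1)
      (A (prepend n y x') - A (prepend n y x))) =
    (fun N => (W (y, x') - W (y, x)) - r N).
  by apply/funext => N; rewrite (involution_kernel_diff y x x' N WA) addrK.
have r0 : r @ \oo --> 0 by apply: continuous_kernel_tail; case: WA.
have := cvgB (cvg_cst (W (y, x') - W (y, x))) r0; rewrite subr0; exact.
Qed.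

(** * Series dominated by powers of one half *)

Lemma ler_sum_half (R : realType) (u : nat -> R) (C : R) (N : nat) :
  0 <= C -> (forall n, `|u n| <= C / 2 ^+ n) ->
  `|\sum_(1 <= n < N) u n| <= C.
Proof.
move=> C0 uC; apply: le_trans (ler_norm_sum _ _ _) _.
case: N => [|N]; first by rewrite big_geq.
(* The bound C alone is not inductive; C - C / 2^N is the geometric sum. *)
suff : \sum_(1 <= n < N.+1) `|u n| <= C - C / 2 ^+ N.
  by move/le_trans; apply; rewrite gerBl divr_ge0 // exprn_ge0.
elim: N => [|N IH]; first by rewrite big_geq // expr0 divr1 subrr.
rewrite big_nat_recr //=; have := uC N.+1; move: IH.
have -> : C / 2 ^+ N = 2 * (C / 2 ^+ N.+1).
  by rewrite exprS invfM mulrCA [2 * _]mulrA divff // mul1r.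
by lra.
Qed.

Lemma is_cvg_sum_half (R : realType) (u : nat -> R) (C : R) :
  (forall n, `|u n| <= C / 2 ^+ n) -> cvgn (fun N => \sum_(1 <= n < N) u n).
Proof.
move=> uC; suff /cvg_ex[l] : cvgn (series (fun n => u n.+1)).
  move=> ul; apply/cvg_ex; exists l; rewrite -cvg_shiftS.
  rewrite [X in X @ \oo](_ : _ = series (fun n => u n.+1)) //.
  by apply/funext => n; rewrite /= big_add1 seriesEnat.
apply: normed_cvg; apply: (@series_le_cvg _ _ (geometric (C * 2^-1) 2^-1)).
- by move=> n; exact: normr_ge0.
- move=> n /=; apply: le_trans (normr_ge0 (u n.+1)) (le_trans (uC n.+1) _).
  by rewrite exprS invfM exprVn mulrA.
- by move=> n /=; apply: le_trans (uC _) _; rewrite exprS invfM exprVn mulrA.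
- apply: is_cvg_geometric_series.
  by rewrite ger0_norm ?invr_ge0 // invf_lt1 ?ltr1n.
Qed.

(** Coordinate n + j carries the weight 2^-(n+j+1), which is compared with
    2^-n to obtain bounds that do not depend on j. *)
Lemma ler_pow2_shift (R : realType) (C : R) (n j : nat) :
  0 <= C -> C / 2 ^+ (n + j).+1 <= C / 2 ^+ n.
Proof.
move=> C0; rewrite ler_wpM2l // lef_pV2 ?posrE ?exprn_gt0 //.
by rewrite ler_weXn2l ?ler1n // -addnS leq_addr.
Qed.

(** * Difference quotients that converge uniformly in a parameter *)

(** Uniformity in t is what allows the limit to be taken under an integral
    whose measure is finite. *)
Definition uniform_derivative0 (R : realType) (T : Type) (F : R -> T -> R)
    (g : T -> R) :=
  forall eps, 0 < eps -> exists2 H, 0 < H &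
    forall h t, 0 < `|h| < H -> `|(F h t - F 0 t) / h - g t| <= eps.

(** A derivative is the limit of a sequence of difference quotients. *)
Lemma measurable_uniform_derivative0 (R : realType) (d : measure_display)
    (T : measurableType d) (F : R -> T -> R) (g : T -> R) :
  (forall h, measurable_fun setT (F h)) -> uniform_derivative0 F g ->
  measurable_fun setT g.
Proof.
move=> mF Fg; pose h n : R := n.+1%:R^-1.
apply: (@measurable_fun_cvg _ _ _ _ (fun n t => (F (h n) t - F 0 t) / h n)).
  by move=> n; apply: measurable_funM => //; exact: measurable_funB.
move=> t _; apply/cvgrPdist_le => eps /Fg[H H0 HF].
near=> n; rewrite distrC; apply: HF.
rewrite /h gtr0_norm ?invr_gt0 ?ltr0Sn //=.
by near: n; exact: near_infty_natSinv_lt (PosNum H0).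
Unshelve. all: by end_near. Qed.

(** The lower bound is convexity, 1 + t <= exp t.  The same inequality at -t
    gives exp t <= 1 / (1 - t), from which the upper bound follows since
    1 - t >= 1/2. *)
Lemma expR_quadratic_remainder (R : realType) (t : R) :
  `|t| <= 2^-1 -> `|expR t - 1 - t| <= 2 * t ^+ 2.
Proof.
rewrite ler_norml => /andP[t1 t2].
have := expR_ge1Dx t; have := expR_ge1Dx (- t).
rewrite expRN => h1 h2; have e0 := expR_gt0 t.
have h3 : (1 - t) * expR t <= 1 by rewrite -ler_pdivlMr // mul1r.
by rewrite ler_norml; apply/andP; split; nra.
Qed.

(** With q the difference quotient of F, the error splits as
    exp (F 0) * ((exp (h q) - 1 - h q) / h + (q - g)), and q is bounded
    because g is. *)
Lemma uniform_derivative0_expR (R : realType) (T : Type) (F : R -> T -> R)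
    (g : T -> R) (M B : R) :
  0 <= B -> (forall t, F 0 t <= M) -> (forall t, `|g t| <= B) ->
  uniform_derivative0 F g ->
  uniform_derivative0 (fun h t => expR (F h t)) (fun t => expR (F 0 t) * g t).
Proof.
move=> B0 FM gB Fg eps eps0.
have E0 : 0 < expR M by exact: expR_gt0.
pose e := eps / (2 * expR M); have e0 : 0 < e by rewrite divr_gt0 // mulr_gt0.
pose C := B + 1; have C0 : 0 < C by rewrite ltr_pwDr.
(* H2 keeps |q| below C, H3 brings h q within the range of the
   quadratic remainder, and H4 makes 2 h q^2 at most e.  The remainder and
   q - g then contribute an error e each. *)
have [H1 H10 F1] := Fg _ e0; have [H2 H20 F2] := Fg 1 ltr01.
pose H3 := (2 * C)^-1; pose H4 := e / (2 * C ^+ 2).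
have H30 : 0 < H3 by rewrite invr_gt0 mulr_gt0.
have H40 : 0 < H4 by rewrite divr_gt0 // mulr_gt0 // exprn_gt0.
exists (Num.min (Num.min H1 H2) (Num.min H3 H4)).
  by rewrite !lt_min H10 H20 H30.
move=> h t /andP[h0]; rewrite !lt_min => /andP[/andP[h1 h2] /andP[h3 h4]].
have {}F1 : `|(F h t - F 0 t) / h - g t| <= e by apply: F1; rewrite h0.
have {}F2 : `|(F h t - F 0 t) / h - g t| <= 1 by apply: F2; rewrite h0.
have hn0 : h != 0 by rewrite -normr_gt0.
move: F1 F2; set q := (F h t - F 0 t) / h => F1 F2.
have -> : F h t = F 0 t + h * q.
  by rewrite /q mulrCA divff // mulr1 addrC subrK.
have qC : `|q| <= C.
  by rewrite -(subrK (g t) q) (le_trans (ler_normD _ _)) // addrC lerD.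
have hq : `|h * q| <= 2^-1.
  rewrite normrM (le_trans (ler_pM _ _ (ltW h3) qC)) // /H3 invfM -mulrA.
  by rewrite mulVf ?mulr1 // gt_eqF.
have -> : (expR (F 0 t + h * q) - expR (F 0 t)) / h - expR (F 0 t) * g t =
    expR (F 0 t) * ((expR (h * q) - 1 - h * q) / h + (q - g t)).
  by rewrite expRD; field.
rewrite normrM gtr0_norm ?expR_gt0 //.
have rem : `|(expR (h * q) - 1 - h * q) / h| <= e.
  rewrite normrM normfV ler_pdivrMr //.
  apply: le_trans (expR_quadratic_remainder hq) _.
  rewrite -(ger0_norm (sqr_ge0 (h * q))) normrX normrM.
  have : `|h| * (2 * C ^+ 2) <= e.
    by rewrite -ler_pdivlMr ?(ltW h4) // mulr_gt0 // exprn_gt0.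
  have : `|q| ^+ 2 <= C ^+ 2 by rewrite lerXn2r // nnegrE // ltW.
  by move: (normr_ge0 q); nra.
have -> : eps = expR M * (e + e).
  by rewrite /e; field; rewrite gt_eqF.
apply: ler_pM; rewrite ?expR_ge0 ?ler_expR //.
by apply: le_trans (ler_normD _ _) _; rewrite lerD.
Qed.

Lemma derivative_Rintegral (R : realType) (d : measure_display)
    (T : measurableType d) (mu : {finite_measure set T -> \bar R})
    (F : R -> T -> R) (g : T -> R) :
  (forall h, mu.-integrable setT (EFin \o F h)) ->
  mu.-integrable setT (EFin \o g) -> uniform_derivative0 F g ->
  (fun h => h^-1 * (\int[mu]_t F h t - \int[mu]_t F 0 t)) @ 0^' -->
    \int[mu]_t g t.
Proof.
move=> iF ig Fg; apply/cvgrPdist_le => eps eps0.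
(* m + 1 rather than m, because the measure may vanish. *)
pose m := fine (mu setT); have m0 : 0 <= m by rewrite fine_ge0.
have e0 : 0 < eps / (m + 1) by rewrite divr_gt0 // ltr_wpDl.
have [H H0 HF] := Fg _ e0.
near=> h; have h0 : 0 < `|h| < H.
  rewrite normr_gt0; apply/andP; split; near: h; first exact: nbhs_dnbhs_neq.
  exact: dnbhs0_lt.
have iD : mu.-integrable setT (EFin \o (fun t => (F h t - F 0 t))).
  by rewrite (_ : _ \o _ = (EFin \o F h) \- (EFin \o F 0%R))%E //;
    exact: integrableB.
have iQ : mu.-integrable setT (EFin \o (fun t => h^-1 * (F h t - F 0 t))).
  by rewrite (_ : _ \o _ = (fun t => (h^-1)%:E * ((F h t - F 0 t)%R)%:E))%E //;
    exact: integrableZl.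
have iG : mu.-integrable setT (EFin \o (fun t => g t - h^-1 * (F h t - F 0 t))).
  rewrite (_ : _ \o _ = (EFin \o g) \-
    (EFin \o (fun t => h^-1 * (F h t - F 0 t))%R))%E //; exact: integrableB.
rewrite -RintegralB // -RintegralZl // -RintegralB //.
apply: le_trans (le_normr_Rintegral _ iG) _ => //.
apply: (@le_trans _ _ (\int[mu]_(t in setT) (eps / (m + 1)))).
  apply: le_Rintegral => //.
  - exact: integrable_norm.
  - exact: finite_measure_integrable_cst.
  - by move=> t _; rewrite distrC mulrC; exact: HF.
rewrite Rintegral_cst // -/m mulrAC ler_pdivrMr ?ltr_wpDl //.
by rewrite ler_pM2l // lerDl.
Unshelve. all: by end_near. Qed.

(** Both notions of derivative are limits of the same quotient, written in two
    different ways. *)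
Lemma derivable_of_quotient0 (R : realType) (f : R -> R) (l : R) :
  (fun h => h^-1 * (f h - f 0)) @ 0^' --> l ->
  derivable f 0 1 /\ derive1 f 0 = l.
Proof.
move=> fl; split.
  apply/cvg_ex; exists l; rewrite [X in X @ _](_ : _ =
    fun h => h^-1 * (f h - f 0)) //.
  by apply/funext => h /=; rewrite [h *: 1]mulr1 addr0.
rewrite /derive1 (_ : (fun h => _) = fun h => h^-1 * (f h - f 0)).
  exact: cvg_lim fl.
by apply/funext => h /=; rewrite addr0.
Qed.

(** * Boundedness and measurability *)

Lemma bounded_integrable (R : realType) (d : measure_display)
    (T : measurableType d) (mu : {finite_measure set T -> \bar R})
    (f : T -> R) (M : R) :
  measurable_fun setT f -> (forall t, `|f t| <= M) ->
  mu.-integrable setT (EFin \o f).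
Proof.
move=> mf fM; apply: measurable_bounded_integrable => //.
  by rewrite ltey_eq fin_num_measure.
exists M; split; first exact: num_real.
by move=> N MN t _; exact: le_trans (fM t) (ltW MN).
Qed.

Lemma measurable_continuous_seqS1 (R : realType) (f : seqS1 R -> R) :
  continuous f -> measurable_fun setT f.
Proof.
move=> /continuousP cf; apply: (measurability _ (RGenOpens.measurableE R)).
move=> _ [_ [a [b ->] <-]]; rewrite setTI; apply: sub_sigma_algebra.
exact/cf/interval_open.
Qed.

Lemma continuous_kernel_bounded (R : realType)
    (W : seqS1 R * seqS1 R -> R) :
  continuous W -> exists M, forall p, `|W p| <= M.
Proof.
move=> cW; have cX : compact (W @` [set: (seqS1 R * seqS1 R)%type]).
  apply: continuous_compact; first exact: continuous_subspaceT.
  exact: compact_seqS1_pair.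
have [M [_ WM]] := compact_bounded cX.
by exists (M + 1) => p; apply: WM; [rewrite ltrDl|exists p].
Qed.

Lemma measurable_kernel_slice (R : realType) (W : seqS1 R * seqS1 R -> R)
    (x : seqS1 R) :
  continuous W -> measurable_fun setT (fun y => W (y, x)).
Proof.
move=> cW; apply: measurable_continuous_seqS1 => y.
apply: (@continuous_comp _ _ _ (fun z => (z, x)) W); last exact: cW.
exact: (@cvg_pair _ _ _ (nbhs y) (nbhs y) (nbhs x) _ _ _ id (fun=> x) cvg_id
  (cvg_cst x)).
Qed.

(** * The derivative of an involution kernel *)

(** Increments of A in coordinate j are Lipschitz with a constant that carries
    the weight of this coordinate in the metric, and the difference quotient at
    a fixed small step approximates the derivative up to the same weight. *)
Lemma class_D_coord_deriv_bound (R : realType) (A : seqS1 R -> R) :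
  class_D A ->
  exists2 B, 0 <= B & forall j x, `|coord_deriv j A x| <= B / 2 ^+ j.+1.
Proof.
move=> [[K K0 AK] _ /(_ 1 ltr01)[H H0 AH]].
exists (K + 1) => [|j x]; first by rewrite addr_ge0.
have H20 : 0 < H / 2 by rewrite divr_gt0.
have hH : 0 < `|H / 2| < H.
  by rewrite gtr0_norm // H20 /= ltr_pdivrMr // ltr_pMr // ltr1n.
have := AH x j _ hH; set q := _ / (H / 2) => qD.
have qK : `|q| <= K / 2 ^+ j.+1.
  rewrite /q normrM normfV ler_pdivrMr ?normr_gt0 ?gt_eqF //.
  apply: le_trans (AK _ _) _; rewrite -mulrA ler_wpM2l // [leRHS]mulrC.
  exact: seq_dist_add_coord.
rewrite -(subrK q (coord_deriv j A x)) (le_trans (ler_normD _ _)) //.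
by rewrite distrC mulrDl addrC lerD.
Qed.

Definition deriv_series (R : realType) (A : seqS1 R -> R) (j : nat)
    (x y : seqS1 R) (N : nat) :=
  \sum_(1 <= n < N) coord_deriv (n + j) A (prepend n y x).

Lemma is_cvg_deriv_series (R : realType) (A : seqS1 R -> R) (j : nat)
    (x y : seqS1 R) : class_D A -> cvgn (deriv_series A j x y).
Proof.
move=> /class_D_coord_deriv_bound[B B0 AB].
apply: (@is_cvg_sum_half _ _ B) => n.
exact: le_trans (AB _ _) (ler_pow2_shift _ _ B0).
Qed.

Lemma deriv_series_bound (R : realType) (A : seqS1 R -> R) : class_D A ->
  exists2 B, 0 <= B & forall j x y, `|limn (deriv_series A j x y)| <= B.
Proof.
move=> DA; have [B B0 AB] := class_D_coord_deriv_bound DA.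
exists B => // j x y.
have cS := is_cvg_deriv_series (j := j) (x := x) (y := y) DA.
rewrite -lim_norm //; apply: limr_le; first exact: is_cvg_norm.
apply: nearW => N; apply: ler_sum_half => // n.
exact: le_trans (AB _ _) (ler_pow2_shift _ _ B0).
Qed.

(** The n-th terms of the two series differ by at most eps * 2^-(n+j), because
    the coordinates of A are differentiable uniformly: the threshold H depends
    neither on the coordinate nor on the point, hence neither on n nor on y. *)
Lemma involution_kernel_derivative (R : realType) (A : seqS1 R -> R)
    (W : seqS1 R * seqS1 R -> R) (Astar : seqS1 R -> R) (j : nat)
    (x : seqS1 R) :
  class_D A -> involution_kernel A W Astar ->
  uniform_derivative0 (fun h y => W (y, add_coord x j h))
    (fun y => limn (deriv_series A j x y)).
Proof.
move=> DA WA eps eps0; have [_ _ /(_ _ eps0)[H H0 AH]] := DA.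
exists H => // h y hH; rewrite add_coord0.
have cS := is_cvg_deriv_series (j := j) (x := x) (y := y) DA.
have cW := cvg_involution_kernel_sum (y := y) (x := x)
  (x' := add_coord x j h) WA.
have cD : (fun N =>
    (\sum_(1 <= n < N) (A (prepend n y (add_coord x j h)) -
                        A (prepend n y x))) / h - deriv_series A j x y N) @ \oo
    --> (W (y, add_coord x j h) - W (y, x)) / h - limn (deriv_series A j x y).
  by apply: cvgB cS; apply: cvgM cW _; exact: cvg_cst.
rewrite -(cvg_lim (@norm_hausdorff _ _) cD) -lim_norm; last by apply: cvgP cD.
apply: limr_le; first by apply: is_cvg_norm; exact: cvgP cD.
apply: nearW => N /=; rewrite mulr_suml -sumrB.
apply: ler_sum_half => [|n]; first exact: ltW.
rewrite prepend_add_coord; apply: le_trans (ler_pow2_shift _ j (ltW eps0)).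
exact: AH.
Qed.

Unset Implicit Arguments.

Theorem theorem7 (R : realType) (A : seqS1 R -> R)
    (W : seqS1 R * seqS1 R -> R) (Astar : seqS1 R -> R)
    (lambdaA lambdaAstar c : R)
    (rhoA rhoAstar : {finite_measure set (seqS1 R) -> \bar R}) :
  class_D A ->
  involution_kernel A W Astar ->
  hoelder_seq Astar ->
  main_eigenvalue A lambdaA -> eigenmeasure A lambdaA rhoA ->
  main_eigenvalue Astar lambdaAstar -> eigenmeasure Astar lambdaAstar rhoAstar ->
  (\int[rhoA]_x \int[rhoAstar]_y (expR (W (y, x) - c))%:E = 1)%E ->
  let psiA := fun x => \int[rhoAstar]_y expR (W (y, x) - c) in
  let dsum := fun (j : nat) (x y : seqS1 R) (N : nat) =>
    \sum_(1 <= n < N) coord_deriv (n + j) A (prepend n y x) in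
  forall (j : nat) (x : seqS1 R),
    [/\ coord_derivable j psiA x,
        forall y, cvgn (dsum j x y),
        rhoAstar.-integrable setT
          (fun y => (expR (W (y, x) - c) * limn (dsum j x y))%:E) &
        coord_deriv j psiA x =
          \int[rhoAstar]_y (expR (W (y, x) - c) * limn (dsum j x y))].
Proof.
move=> DA WA _ _ _ _ _ _ psiA dsum j x.
have [cW _] := WA; have [M WM] := continuous_kernel_bounded cW.
have [B B0 SB] := deriv_series_bound DA.
pose F h y := W (y, add_coord x j h) - c.
pose S y := limn (deriv_series A j x y).
have FM h y : F h y <= M - c by rewrite lerB // (le_trans (ler_norm _)).
have FS : uniform_derivative0 F S.
  move=> eps /(involution_kernel_derivative j x DA WA)[H H0 HW].
  exists H => // h y /HW => /(_ y); congr (`|_ / _ - _| <= _).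
  by rewrite /F; lra.
have mF h : measurable_fun setT (F h).
  by apply: measurable_funB => //; exact: measurable_kernel_slice.
have mE h : measurable_fun setT (fun y => expR (F h y)).
  by apply: measurableT_comp => //; exact: mF.
have ES := uniform_derivative0_expR B0 (FM 0) (SB j x) FS.
have iE h : rhoAstar.-integrable setT (EFin \o (fun y => expR (F h y))).
  apply: (@bounded_integrable _ _ _ rhoAstar _ (expR (M - c)) (mE h)) => y.
  by rewrite ger0_norm ?expR_ge0 // ler_expR.
have iS : rhoAstar.-integrable setT (EFin \o (fun y => expR (F 0 y) * S y)).
  apply: (@bounded_integrable _ _ _ rhoAstar _ (expR (M - c) * B)).
    exact: measurable_uniform_derivative0 mE ES.
  by move=> y; rewrite normrM ler_pM ?SB // ger0_norm ?expR_ge0 ?ler_expR.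
have F0 : F 0 = fun y => W (y, x) - c by rewrite /F add_coord0.
have [dpsi psi'] := derivable_of_quotient0 (derivative_Rintegral iE iS ES).
rewrite F0 in iS psi'; split.
- exact: dpsi.
- by move=> y; exact: is_cvg_deriv_series.
- exact: iS.
- exact: psi'.
Qed.
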